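(* Let $\Theta=\begin{pmatrix}\theta^1_1&\theta^2_1\\ \theta^1_2&\theta^2_2\end{pmatrix}$ be a real matrix whose entries $\theta^i_j$, $i,j=1,2$, together with $1$, are linearly independent over $\mathbb Z$. Then $\beta(\Theta)\geqslant\alpha(\Theta)\,g_3(\alpha(\Theta))$, where for $\alpha\geqslant1$ $$g_3(\alpha)=\frac{1-\alpha+\sqrt{(1-\alpha)^2+4\alpha(2\alpha^2-2\alpha+1)}}{2\alpha}.$$
   Context: $\|\cdot\|$ = distance to nearest integer. $L_j(\mathbf x)=\theta^1_jx_1+\theta^2_jx_2$ for $\mathbf x=(x_1,x_2)\in\mathbb Z^2$, $j=1,2$. Jarník's function: $\psi_\Theta(t)=\min_{\mathbf x\in\mathbb Z^2,\,0<\max(|x_1|,|x_2|)\leqslant t}\max_{j=1,2}\|L_j(\mathbf x)\|$. $\alpha(\Theta)$ is the supremum of $\gamma$ with $\limsup_{t\to+\infty}t^\gamma\psi_\Theta(t)<+\infty$, and $\beta(\Theta)$ is the supremum of $\gamma$ with $\liminf_{t\to+\infty}t^\gamma\psi_\Theta(t)<+\infty$. (One always has $\alpha(\Theta)\geqslant1$.) *)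

(* Defs.v *)
From HB Require Import structures.
From mathcomp Require Import all_boot all_order all_algebra.
From mathcomp Require Import all_classical all_reals all_analysis.
Set Implicit Arguments.
Unset Strict Implicit.
Unset Printing Implicit Defensive.
Import Order.TTheory GRing.Theory Num.Theory.
Import numFieldNormedType.Exports.
Local Open Scope classical_set_scope.
Local Open Scope ring_scope.

Definition dist_int (R : realType) (x : R) : R :=
  inf [set `|x - p%:~R| | p in [set: int]].

(* The entry theta^i_j is [Theta j i]: row j of Theta holds the
   coefficients of L_j, and the indices 1, 2 are 0, 1 : 'I_2. *)
Definition linform (R : realType) (Theta : 'M[R]_2) (j : 'I_2)
    (x : 'cV[int]_2) : R :=
  \sum_(i < 2) Theta j i * (x i 0)%:~R.

Definition height (x : 'cV[int]_2) : int := Num.max `|x 0 0| `|x 1 0|.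

(* For 1 <= t the set is finite and nonempty, so the infimum is a minimum; for
   t < 1 it is empty and its infimum is 0, which does not affect the behaviour
   at +oo. *)
Definition jarnik_psi (R : realType) (Theta : 'M[R]_2) (t : R) : R :=
  inf [set Num.max (dist_int (linform Theta 0 x)) (dist_int (linform Theta 1 x))
      | x in [set x : 'cV[int]_2 | 0 < height x /\ (height x)%:~R <= t]].

Definition uniform_exponent (R : realType) (Theta : 'M[R]_2) : \bar R :=
  ereal_sup [set gamma%:E | gamma in [set gamma : R |
    (limf_esup (fun t : R => (t `^ gamma * jarnik_psi Theta t)%:E)
       (pinfty_nbhs R) < +oo)%E]].

Definition ordinary_exponent (R : realType) (Theta : 'M[R]_2) : \bar R :=
  ereal_sup [set gamma%:E | gamma in [set gamma : R |
    (limf_einf (fun t : R => (t `^ gamma * jarnik_psi Theta t)%:E)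
       (pinfty_nbhs R) < +oo)%E]].

Definition entries_and_one_independent (R : realType) (Theta : 'M[R]_2) : Prop :=
  forall (c0 : int) (c : 'M[int]_2),
    c0%:~R + \sum_(j < 2) \sum_(i < 2) (c j i)%:~R * Theta j i = 0 ->
    c0 = 0 /\ c = 0.

Definition g3 (R : realType) (a : R) : R :=
  (1 - a + Num.sqrt ((1 - a) ^+ 2 + 4 * a * (2 * a ^+ 2 - 2 * a + 1)))
  / (2 * a).

(* The exponents may be +oo.  [er_map] extends g3 by g3 (+oo) = +oo, its limit
   at +oo, so that the bound becomes +oo when the uniform exponent is +oo. *)
Definition g3e (R : realType) : \bar R -> \bar R := er_map (@g3 R).

(* Main.v *)
(* Let [z_n = (x_n, y_n)] in Z^4 be the successive minimal points, [X_n] the height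
   of [x_n] and [zeta_n] the larger of the two residues [|L_j(x_n) - y_(n,j)|]; a
   uniform exponent [> g] means [zeta_n <= X_(n+1)^-g] and an ordinary exponent
   [< b] means [zeta_n >= X_n^-b], for large [n].

   The minors [x_i L_j' - x_i' L_j] of two consecutive points have size comparable
   to [zeta_n X_(n+1)], and they only depend, up to sign, on the plane spanned by
   the two points, since these form a basis of its lattice. So if
   [z_v, ..., z_k] lie in one plane, [zeta_v X_(v+1)] is at most a constant times
   [zeta_(k-1) X_k]. If moreover [z_(v-1), z_(k-1), z_k, z_(k+1)] are independent,
   their determinant gives [1 <= 24 zeta_(v-1) zeta_(k-1) X_k X_(k+1)]. For [g > 1]
   linear independence of the entries and 1 provides infinitely many such pairs
   [v < k]. With [u = log X_v] and [w = log X_k] the two bounds read, up to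
   constants,
     [g^2 u <= (b + g - g^2) w]   and   [(g - 1) w <= (b - 1) u],
   whence [g^2 (g - 1) <= (b + g - g^2) (b - 1)]. This is stronger than
   [b >= g * g3 g], which is [b^2 + b (g - 1) >= 2 g^3 - 2 g^2 + g]: the
   difference of the two is [g^2 (b - g)]. *)
Require Import Defs.
From mathcomp Require Import all_boot all_order all_algebra.
From mathcomp Require Import all_classical all_reals all_analysis.
From mathcomp Require Import perm ring lra zify.
Set Implicit Arguments.
Unset Strict Implicit.
Unset Printing Implicit Defensive.
Import Order.TTheory GRing.Theory Num.Theory.
Import numFieldNormedType.Exports.
Local Open Scope classical_set_scope.
Local Open Scope ring_scope.

(** * Distances to integers and Dirichlet's theorem *)

Lemma dist_int_le (R : realType) (x : R) (p : int) :
  dist_int x <= `|x - p%:~R|.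
Proof.
apply: inf_lbound; last by exists p.
by exists 0 => _ [q _ <-]; exact: normr_ge0.
Qed.

Lemma dist_int_attained (R : realType) (x : R) :
  exists p : int, dist_int x = `|x - p%:~R|.
Proof.
set f := Num.floor x.
have [hl hu] : f%:~R <= x /\ x < f%:~R + 1.
  by split; [exact: floor_le_tmp|rewrite -intrD1; exact: floorD1_gt].
suff [p hp] : exists p : int, forall q : int, `|x - p%:~R| <= `|x - q%:~R|.
  exists p; apply/le_anti; rewrite dist_int_le /=; apply: lb_le_inf.
    by exists `|x - 0%:~R|, 0.
  by move=> _ [q _ <-].
have far (q : int) : x - f%:~R <= `|x - q%:~R| \/ f%:~R + 1 - x <= `|x - q%:~R|.
  have [qf|fq] := leP q f.
    left; apply: le_trans (ler_norm _); rewrite lerD2l lerN2.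
    by rewrite ler_int.
  right; rewrite distrC; apply: le_trans (ler_norm _).
  rewrite lerD2r -intrD1 ler_int; lia.
have nl : `|x - f%:~R| = x - f%:~R by rewrite ger0_norm // subr_ge0.
have nu : `|x - (f + 1)%:~R| = f%:~R + 1 - x.
  by rewrite distrC ger0_norm intrD1 // subr_ge0 ltW.
have [le|lt] := leP (x - f%:~R) (f%:~R + 1 - x).
  by exists f => q; rewrite nl; case: (far q) => // h; lra.
by exists (f + 1) => q; rewrite nu; case: (far q) => // h; lra.
Qed.

Lemma dist_int_ge0 (R : realType) (x : R) : 0 <= dist_int x.
Proof. by have [p ->] := dist_int_attained x. Qed.

(* [zpoint] is an integer vector [(x, y)] of Z^4, [y] being the candidate
   nearest integers to the values of the linear forms at [x]. *)
Definition zpoint := ('cV[int]_2 * 'cV[int]_2)%type.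

Definition residue (R : realType) (Theta : 'M[R]_2) (z : zpoint) (j : 'I_2) : R :=
  linform Theta j z.1 - (z.2 j 0)%:~R.

Definition zeta (R : realType) (Theta : 'M[R]_2) (z : zpoint) : R :=
  Num.max `|residue Theta z 0| `|residue Theta z 1|.

Definition radius (R : realType) (Theta : 'M[R]_2) (x : 'cV[int]_2) : R :=
  Num.max (dist_int (linform Theta 0 x)) (dist_int (linform Theta 1 x)).

Lemma ord2P (P : 'I_2 -> Prop) : P 0 -> P 1 -> forall i, P i.
Proof.
move=> P0 P1 i; case: (unliftP 0 i) => [j ->|-> //].
by rewrite (ord1 j) (_ : lift 0 0 = 1) //; apply: val_inj.
Qed.

Lemma residue_le_zeta (R : realType) (Theta : 'M[R]_2) z j :
  `|residue Theta z j| <= zeta Theta z.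
Proof.
by elim/ord2P: j; rewrite /zeta le_max lexx ?orbT.
Qed.

Lemma zeta_attained (R : realType) (Theta : 'M[R]_2) z :
  exists j, zeta Theta z = `|residue Theta z j|.
Proof.
by rewrite /zeta; case: leP => _; [exists 1|exists 0].
Qed.

Lemma zeta_ge0 (R : realType) (Theta : 'M[R]_2) z : 0 <= zeta Theta z.
Proof. by have [j ->] := zeta_attained Theta z. Qed.

Lemma coord_le_height (x : 'cV[int]_2) i : `|x i 0| <= height x.
Proof. by elim/ord2P: i; rewrite /height le_max lexx ?orbT. Qed.

Lemma height_attained (x : 'cV[int]_2) : exists i, height x = `|x i 0|.
Proof. by rewrite /height; case: leP => _; [exists 1|exists 0]. Qed.

Lemma height_ge0 x : 0 <= height x.
Proof. by have [i ->] := height_attained x. Qed.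

Lemma height_eq0 x : (height x == 0) = (x == 0).
Proof.
apply/idP/eqP => [/eqP h|->].
  apply/matrixP => i j; rewrite ord1 mxE; apply/eqP; rewrite -normr_eq0.
  by rewrite eq_le normr_ge0 andbT -h coord_le_height.
by rewrite /height !mxE normr0 maxxx.
Qed.

Lemma height_gt0 x : (0 < height x) = (x != 0).
Proof. by rewrite lt_neqAle height_ge0 andbT eq_sym height_eq0. Qed.

Lemma radius_ge0 (R : realType) (Theta : 'M[R]_2) x : 0 <= radius Theta x.
Proof. by rewrite /radius le_max dist_int_ge0. Qed.

Lemma radius_le_zeta (R : realType) (Theta : 'M[R]_2) z :
  radius Theta z.1 <= zeta Theta z.
Proof.
by rewrite /radius ge_max; apply/andP; split;
  apply: le_trans (dist_int_le _ (z.2 _ 0)) (residue_le_zeta _ _ _).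
Qed.

Lemma radius_attained (R : realType) (Theta : 'M[R]_2) x :
  exists y : 'cV[int]_2, radius Theta x = zeta Theta (x, y).
Proof.
have [p hp] := dist_int_attained (linform Theta 0 x).
have [q hq] := dist_int_attained (linform Theta 1 x).
exists (\col_j (if j == 0 then p else q)).
by rewrite /radius /zeta /residue /= !mxE /= -hp -hq.
Qed.

Lemma jarnik_psi_le (R : realType) (Theta : 'M[R]_2) (t : R) x :
  0 < height x -> (height x)%:~R <= t -> jarnik_psi Theta t <= radius Theta x.
Proof.
move=> h0 ht; apply: inf_lbound; last by exists x.
by exists 0 => _ [y _ <-]; exact: (radius_ge0 Theta y).
Qed.

Lemma le_jarnik_psi (R : realType) (Theta : 'M[R]_2) (t c : R) :
  1 <= t ->
  (forall x, 0 < height x -> (height x)%:~R <= t -> c <= radius Theta x) ->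
  c <= jarnik_psi Theta t.
Proof.
move=> t1 H; apply: lb_le_inf; last by move=> _ [x [h0 ht] <-]; exact: H.
apply: image_nonempty; exists (const_mx 1); split.
  by rewrite /height !mxE.
by rewrite /height !mxE normr1 maxxx.
Qed.

Lemma linformB (R : realType) (Theta : 'M[R]_2) j x y :
  linform Theta j (x - y) = linform Theta j x - linform Theta j y.
Proof.
by rewrite /linform -sumrB; apply: eq_bigr => i _; rewrite !mxE intrB mulrBr.
Qed.

(** Pigeonhole: the [(T + 1) ^ 2] vectors with coordinates in [0..T] have pairs of fractional parts
    in [T ^ 2] boxes of side [1 / T], and two vectors sharing a box are subtracted. Inside the proof
    [T] is the predecessor. *)
Lemma dirichlet (R : realType) (Theta : 'M[R]_2) (T : nat) : (0 < T)%N ->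
  exists x, [/\ 0 < height x, height x <= T%:Z & radius Theta x <= T%:R^-1].
Proof.
case: T => // T _.
pose x (a : 'I_T.+2 * 'I_T.+2) : 'cV[int]_2 :=
  \col_i (if i == 0 then (a.1 : nat)%:Z else (a.2 : nat)%:Z).
pose fr j a := linform Theta j (x a) - (Num.floor (linform Theta j (x a)))%:~R.
have fr0 j a : 0 <= fr j a by rewrite subr_ge0 floor_le_tmp.
have fr1 j a : fr j a < 1.
  by rewrite ltrBlDl -intrD1 floorD1_gt.
pose fl j a := Num.floor (T.+1%:R * fr j a).
pose box j a : 'I_T.+1 := inord `|fl j a|%N.
have flE j a : (box j a : nat)%:Z = fl j a.
  have h0 : 0 <= fl j a by rewrite floor_ge0 mulr_ge0.
  have h1 : fl j a < T.+1%:Z.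
    rewrite floor_lt_int; apply: (lt_le_trans (y := T.+1%:R * 1)); last by rewrite mulr1.
    by rewrite ltr_pM2l.
  by rewrite inordK; lia.
have [a [b [ab eqb]]] : exists a b : 'I_T.+2 * 'I_T.+2, a != b /\ forall j, box j a = box j b.
  apply: contrapT => H.
  have inj : injective (fun a => (box 0 a, box 1 a)).
    move=> a b [e0 e1]; apply/eqP/negPn/negP => ab; apply: H; exists a, b.
    by split=> // j; elim/ord2P: j.
  have := leq_card _ inj; rewrite !card_prod !card_ord.
  by rewrite leqNgt ltn_mul.
exists (x a - x b); split.
- rewrite height_gt0; apply: contra_neq ab => /eqP; rewrite subr_eq0 => /eqP e.
  have := congr1 (fun m : 'cV[int]_2 => m 0 0) e.
  have := congr1 (fun m : 'cV[int]_2 => m 1 0) e.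
  rewrite !mxE /= => -[e1] [e0].
  by case: a b e0 e1 {e eqb} => a1 a2 [b1 b2] /= /val_inj -> /val_inj ->.
- have [i ->] := height_attained (x a - x b); rewrite !mxE.
  have dl (p q : nat) : (p < T.+2)%N -> (q < T.+2)%N -> `|p%:Z - q%:Z| <= T.+1%:Z by lia.
  by case: ifP => _; apply: dl; exact: ltn_ord.
- have bnd j : dist_int (linform Theta j (x a - x b)) <= T.+1%:R^-1.
    apply: le_trans (dist_int_le _ (Num.floor (linform Theta j (x a)) -
      Num.floor (linform Theta j (x b)))) _.
    have -> : linform Theta j (x a - x b) - (Num.floor (linform Theta j (x a)) -
        Num.floor (linform Theta j (x b)))%:~R = fr j a - fr j b.
      by rewrite linformB intrB /fr; ring.
    rewrite -(ler_pM2l (_ : 0 < T.+1%:R :> R)) // mulfV //.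
    rewrite -[X in X * _](ger0_norm (_ : 0 <= T.+1%:R :> R)) // -normrM mulrBr.
    have e : fl j a = fl j b by rewrite -!flE eqb.
    have := floor_le_tmp (T.+1%:R * fr j a); have := floor_le_tmp (T.+1%:R * fr j b).
    have := floorD1_gt (T.+1%:R * fr j a); have := floorD1_gt (T.+1%:R * fr j b).
    rewrite -/(fl j a) -/(fl j b) e !intrD1 => h1 h2 h3 h4.
    by rewrite ler_norml; lra.
  by rewrite /radius ge_max !bnd.
Qed.

Lemma linform0 (R : realType) (Theta : 'M[R]_2) j : linform Theta j 0 = 0.
Proof. by rewrite -[0 : 'cV_2](subrr 0) linformB subrr. Qed.

(** A zero radius makes the first form an integer at [x], which is an integer relation between the
    first row of [Theta] and 1. *)
Lemma radius_gt0 (R : realType) (Theta : 'M[R]_2) x :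
  entries_and_one_independent Theta -> x != 0 -> 0 < radius Theta x.
Proof.
move=> indep x0; rewrite lt_neqAle radius_ge0 andbT eq_sym.
apply: contra_neq x0 => r0.
have d0 : dist_int (linform Theta 0 x) = 0.
  apply/le_anti; rewrite dist_int_ge0 andbT -r0 /radius le_max lexx //.
have [p hp] := dist_int_attained (linform Theta 0 x).
move/esym/eqP: hp; rewrite d0 normr_eq0 subr_eq0 => /eqP hp.
have := indep (- p) (\matrix_(j, i) if j == 0 then x i 0 else 0).
rewrite !big_ord_recl !big_ord0 !mxE /= !mul0r !addr0.
move: hp; rewrite /linform !big_ord_recl big_ord0 addr0 intrN => <- h.
have [|_ /matrixP e] := h; first by ring.
apply/matrixP => i j; rewrite ord1.
by have := e 0 i; rewrite !mxE.
Qed.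

Lemma radius_min (R : realType) (Theta : 'M[R]_2) (h : nat) : (0 < h)%N ->
  exists x, [/\ 0 < height x, height x <= h%:Z &
    forall x', 0 < height x' -> height x' <= h%:Z -> radius Theta x <= radius Theta x'].
Proof.
move=> h0.
pose v (a : 'I_(h + h).+1 * 'I_(h + h).+1) : 'cV[int]_2 :=
  \col_i ((if i == 0 then (a.1 : nat)%:Z else (a.2 : nat)%:Z) - h%:Z).
have vh a : height (v a) <= h%:Z.
  have [i ->] := height_attained (v a); rewrite !mxE.
  have := ltn_ord a.1; have := ltn_ord a.2; by case: ifP; lia.
have vP x : height x <= h%:Z -> exists a, x = v a.
  move=> hx; have b i := le_trans (coord_le_height x i) hx.
  have lt i : (`|(x i 0 + h%:Z)%R|%N < (h + h).+1)%N by have := b i; lia.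
  exists (Ordinal (lt 0), Ordinal (lt 1)); apply/matrixP => i j; rewrite ord1 mxE /=.
  by have := b i; elim/ord2P: i => /=; lia.
have [|a0 ha0] := vP (const_mx 1); first by rewrite /height !mxE; lia.
have pa0 : 0 < height (v a0) by rewrite -ha0 /height !mxE.
case: (@arg_minP _ _ _ a0 (fun a => 0 < height (v a)) (fun a => radius Theta (v a)) pa0).
move=> a ha min; exists (v a); split=> // x' x'0 /vP [b eb].
by rewrite eb; apply: min; rewrite -eb.
Qed.

Lemma small_radius (R : realType) (Theta : 'M[R]_2) (e : R) : 0 < e ->
  exists x, 0 < height x /\ radius Theta x < e.
Proof.
move=> e0; pose T := (Num.truncn e^-1).+1.
have [x [x0 _ hx]] := @dirichlet R Theta T isT.
exists x; split=> //; apply: le_lt_trans hx _.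
rewrite -[e]invrK ltf_pV2 ?posrE ?invr_gt0 ?ltr0n //.
exact: truncnS_gt.
Qed.

(** * Minimal points *)

Definition minimal_vector (R : realType) (Theta : 'M[R]_2) (x : 'cV[int]_2) :=
  0 < height x /\
  forall x', 0 < height x' -> height x' <= height x -> radius Theta x <= radius Theta x'.

(** Take the least height [h] at which some radius drops below that of [x], then a vector of least
    radius among those of height at most [h]. *)
Lemma next_minimal_vector (R : realType) (Theta : 'M[R]_2) x :
  entries_and_one_independent Theta -> minimal_vector Theta x ->
  exists x', [/\ minimal_vector Theta x', radius Theta x' < radius Theta x,
    height x < height x' &
    forall y, 0 < height y -> height y < height x' -> radius Theta x <= radius Theta y].
Proof.
move=> indep [x0 minx].
pose P n := `[< exists y, [/\ 0 < height y, height y = n%:Z & radius Theta y < radius Theta x] >].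
have exP : exists n, P n.
  have [|y [y0 hy]] := @small_radius R Theta (radius Theta x).
    by apply: radius_gt0 => //; rewrite -height_gt0.
  exists `|height y|%N; apply/asboolP; exists y; split=> //.
  by rewrite gez0_abs // height_ge0.
case: (ex_minnP exP) => h /asboolP [y [y0 hy ryx]] hmin.
have small w : 0 < height w -> height w < h%:Z -> radius Theta x <= radius Theta w.
  move=> w0 wh; rewrite leNgt; apply/negP => rw.
  have /hmin : P `|height w|%N.
    by apply/asboolP; exists w; split=> //; rewrite gez0_abs // height_ge0.
  by lia.
have h_gt0 : (0 < h)%N by lia.
have [x' [x'0 x'h minx']] := @radius_min R Theta h h_gt0.
have rx' : radius Theta x' < radius Theta x.
  by apply: le_lt_trans ryx; apply: minx'; rewrite // hy.
have hx' : height x' = h%:Z.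
  apply/le_anti; rewrite x'h /= leNgt; apply/negP => /(small _ x'0).
  by rewrite leNgt rx'.
exists x'; split=> //; last by rewrite hx'.
  by split=> //; rewrite hx'.
by rewrite ltNge; apply/negP => /(minx _ x'0); rewrite leNgt rx'.
Qed.

(** The last two clauses make [zeta Theta (z n)] the value of Jarnik's function from the height of
    [z n] up to, but excluding, that of [z n.+1]. *)
Definition minimal_points (R : realType) (Theta : 'M[R]_2) (z : nat -> zpoint) :=
  [/\ forall n, 0 < height (z n).1,
      forall n, height (z n).1 < height (z n.+1).1,
      forall n, zeta Theta (z n.+1) < zeta Theta (z n),
      forall n, zeta Theta (z n) = radius Theta (z n).1 &
      forall n x, 0 < height x -> height x < height (z n.+1).1 ->
        zeta Theta (z n) <= radius Theta x].

Lemma exists_minimal_points (R : realType) (Theta : 'M[R]_2) :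
  entries_and_one_independent Theta -> exists z, minimal_points Theta z.
Proof.
move=> indep.
have [x0 [x0_gt0 x0h minx0]] := @radius_min R Theta 1 isT.
have min0 : minimal_vector Theta x0.
  split=> // x' x'0 hx'; apply: minx0 => //; exact: le_trans hx' x0h.
have step (x : {x | minimal_vector Theta x}) : {x' : {x | minimal_vector Theta x} |
    [/\ radius Theta (sval x') < radius Theta (sval x),
    height (sval x) < height (sval x') &
    forall y, 0 < height y -> height y < height (sval x') ->
      radius Theta (sval x) <= radius Theta y]}.
  case: x => x mx; apply: cid.
  by have [x' [mx' r h m]] := next_minimal_vector indep mx; exists (exist _ x' mx').
have [y hy] := choice (radius_attained Theta).
pose s n := iter n (fun x => sval (step x)) (exist _ x0 min0).
have sP n := svalP (step (s n)).
exists (fun n => (sval (s n), y (sval (s n)))); split=> /=.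
- by move=> n; have [] := svalP (s n).
- by move=> n; have [] := sP n.
- by move=> n; rewrite -!hy; have [] := sP n.
- by move=> n; rewrite -hy.
- by move=> n x h0 h1; rewrite -hy; have [_ _] := sP n; exact.
Qed.

Lemma minimal_points_zeta_gt0 (R : realType) (Theta : 'M[R]_2) z n :
  minimal_points Theta z -> 0 < zeta Theta (z n).
Proof. by move=> [_ _ zS _ _]; apply: le_lt_trans (zS n); exact: zeta_ge0. Qed.

Lemma radius_lt1 (R : realType) (Theta : 'M[R]_2) x : radius Theta x < 1.
Proof.
have d1 (r : R) : dist_int r < 1.
  apply: le_lt_trans (dist_int_le _ (Num.floor r)) _.
  by rewrite ger0_norm ?subr_ge0 ?floor_le_tmp // ltrBlDl -intrD1 floorD1_gt.
by rewrite /radius gt_max !d1.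
Qed.

(** The first component vanishes because no nonzero vector lower than [z n.+1] beats [z n]; the
    residues are then integers of absolute value below 1. *)
Lemma minimal_points_eq0 (R : realType) (Theta : 'M[R]_2) z n (w : zpoint) :
  minimal_points Theta z -> height w.1 < height (z n.+1).1 ->
  zeta Theta w < zeta Theta (z n) -> w = 0.
Proof.
move=> [_ _ _ rE rmin] hw zw.
have /eqP w1 : w.1 == 0.
  rewrite -height_eq0 eq_le height_ge0 andbT leNgt; apply/negP => w0.
  have := rmin _ _ w0 hw; rewrite leNgt => /negP; apply.
  exact: le_lt_trans (radius_le_zeta _ _) zw.
case: w w1 zw {hw} => x y /= -> zw; congr pair; apply/matrixP => j k.
rewrite ord1 mxE; have := le_lt_trans (residue_le_zeta Theta (0, y) j) zw.
rewrite /residue /= linform0 sub0r normrN -intr_norm.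
by move=> /lt_trans - /(_ 1); rewrite rE radius_lt1 ltrz1 => /(_ isT); lia.
Qed.

(** * Minors of two consecutive minimal points *)

Lemma residueB (R : realType) (Theta : 'M[R]_2) (z z' : zpoint) j :
  residue Theta (z - z') j = residue Theta z j - residue Theta z' j.
Proof. by rewrite /residue linformB !mxE intrB; ring. Qed.

Lemma residueD (R : realType) (Theta : 'M[R]_2) (z z' : zpoint) j :
  residue Theta (z + z') j = residue Theta z j + residue Theta z' j.
Proof.
by rewrite -[z' in LHS]opprK residueB -[- z']sub0r residueB /residue !mxE linform0; ring.
Qed.

Lemma residueZ (R : realType) (Theta : 'M[R]_2) (e : int) (z : zpoint) j :
  residue Theta (e *: z) j = e%:~R * residue Theta z j.
Proof.
rewrite /residue /linform mulrBr mulr_sumr !mxE intrM; congr (_ - _).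
by apply: eq_bigr => i _; rewrite !mxE intrM; ring.
Qed.

Definition cross (R : realType) (Theta : 'M[R]_2) (z z' : zpoint) (i j : 'I_2) : R :=
  (z.1 i 0)%:~R * residue Theta z' j - (z'.1 i 0)%:~R * residue Theta z j.

Lemma coord_le_heightr (R : realType) (x : 'cV[int]_2) i :
  `|(x i 0)%:~R| <= (height x)%:~R :> R.
Proof. by rewrite -intr_norm ler_int coord_le_height. Qed.

Lemma cross_le (R : realType) (Theta : 'M[R]_2) z n i j : minimal_points Theta z ->
  `|cross Theta (z n) (z n.+1) i j| <= 2 * (zeta Theta (z n) * (height (z n.+1).1)%:~R).
Proof.
move=> [_ hS zS _ _]; apply: le_trans (ler_normB _ _) _; rewrite !normrM.
have X0 : 0 <= (height (z n.+1).1)%:~R :> R by rewrite ler0z height_ge0.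
rewrite (_ : 2 * _ = zeta Theta (z n) * (height (z n.+1).1)%:~R +
  zeta Theta (z n) * (height (z n.+1).1)%:~R); last by ring.
apply: lerD; rewrite mulrC; apply: ler_pM => //.
- apply: le_trans (residue_le_zeta _ _ _) _; exact: ltW.
- apply: le_trans (coord_le_heightr _ _ _) _; rewrite ler_int; exact: ltW.
- exact: residue_le_zeta.
- exact: coord_le_heightr.
Qed.

(** The product [x * l] exceeds 3/4 of its largest possible value, so [x] and [l] share a sign [e]
    and each reaches 3/4 of its own bound in absolute value. *)
Lemma near_product_pos (R : realFieldType) (X Z x l : R) :
  0 < X -> 0 < Z -> `|x| <= X -> `|l| <= Z -> `|x * l - X * Z| < X * Z / 4 ->
  exists e : int, [/\ e = 1 \/ e = -1, `|X - e%:~R * x| <= X / 4 & `|l - e%:~R * Z| <= Z / 4].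
Proof.
move=> X0 Z0; rewrite !ler_norml => /andP[x1 x2] /andP[l1 l2].
rewrite ltr_norml => /andP[h1 h2].
have XZ : 0 < X * Z by exact: mulr_gt0.
have [xpos|xneg] := leP 0 x.
  have l0 : 0 <= l by nra.
  exists 1; split; first (by left); rewrite !mul1r ler_norml.
    have : (X * (3 / 4) - x) * Z <= 0 by nra.
    rewrite pmulr_lle0 // => ?; apply/andP; split; lra.
  have : X * (Z * (3 / 4) - l) <= 0 by nra.
  rewrite pmulr_rle0 // => ?; apply/andP; split; lra.
have l0 : l <= 0 by nra.
exists (-1); split; first (by right); rewrite !mulN1r ler_norml.
  have : (X * (3 / 4) + x) * Z <= 0 by nra.
  rewrite pmulr_lle0 // => ?; apply/andP; split; lra.
have : X * (Z * (3 / 4) + l) <= 0 by nra.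
rewrite pmulr_rle0 // => ?; apply/andP; split; lra.
Qed.

(** Changing the signs of [x] and [x'] together, or of [l] and [l'] together, affects neither the
    hypotheses nor [e]; this reduces to positive [x'] and [l]. *)
Lemma near_product (R : realFieldType) (x x' l l' : R) :
  x' != 0 -> l != 0 -> `|x| <= `|x'| -> `|l'| <= `|l| ->
  `|x * l' - x' * l| < `|x'| * `|l| / 4 ->
  exists e : int, [/\ e = 1 \/ e = -1, `|x' - e%:~R * x| <= `|x'| / 4 &
    `|l' - e%:~R * l| <= `|l| / 4].
Proof.
move=> x'0 l0 hx hl.
wlog x'_gt0 : x x' x'0 hx / 0 < x' => [H h|].
  have [|x'_le0] := ltP 0 x'; first by move=> ?; exact: H.
  have [||||e [e1 e2 e3]] := H (- x) (- x').
  - by rewrite oppr_eq0.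
  - by rewrite !normrN.
  - by rewrite oppr_gt0 lt_neqAle x'0.
  - by rewrite -[ltLHS]normrN !mulNr -opprD opprK normrN.
  exists e; split=> //; move: e2; rewrite normrN; apply: le_trans.
  by rewrite -normrN le_eqVlt; apply/orP; left; apply/eqP; congr `|_|; ring.
wlog l_gt0 : l l' l0 hl / 0 < l => [H h|].
  have [|l_le0] := ltP 0 l; first by move=> ?; exact: H.
  have [||||e [e1 e2 e3]] := H (- l) (- l').
  - by rewrite oppr_eq0.
  - by rewrite !normrN.
  - by rewrite oppr_gt0 lt_neqAle l0.
  - by rewrite -[ltLHS]normrN !mulrN -opprD opprK normrN.
  exists e; split=> //; move: e3; rewrite normrN; apply: le_trans.
  by rewrite -normrN le_eqVlt; apply/orP; left; apply/eqP; congr `|_|; ring.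
rewrite (gtr0_norm x'_gt0) (gtr0_norm l_gt0) in hx hl * => h.
exact: near_product_pos.
Qed.

(* Otherwise [z_(n+1) - z_n] or [z_(n+1) + z_n] would be too small in both senses. *)
Lemma zeta_height_le_cross (R : realType) (Theta : 'M[R]_2) z n : minimal_points Theta z ->
  exists i j, zeta Theta (z n) * (height (z n.+1).1)%:~R <= 4 * `|cross Theta (z n) (z n.+1) i j|.
Proof.
move=> mz; have [h0 hS zS _ _] := mz.
set Z := zeta _ _; set X : R := (height _)%:~R.
have X_gt0 : 0 < X by rewrite ltr0z.
have Z_gt0 : 0 < Z by exact: minimal_points_zeta_gt0.
apply: contrapT => H.
have small i j : `|cross Theta (z n) (z n.+1) i j| < X * Z / 4.
  by rewrite ltNge; apply/negP => le; apply: H; exists i, j; lra.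
(* At the [i] and [j] chosen here, one of the two terms of the minor has full size [X * Z], so the
   other must nearly cancel it. *)
have [i] := height_attained (z n.+1).1; move=> /(congr1 (fun k : int => k%:~R : R)).
rewrite intr_norm -/X => Xi.
have [j Zj] := zeta_attained Theta (z n); rewrite -/Z in Zj.
have xX k : `|((z n).1 k 0)%:~R| <= X.
  by apply: le_trans (coord_le_heightr _ _ _) _; rewrite ler_int ltW.
have lZ k : `|residue Theta (z n.+1) k| <= Z.
  by apply: le_trans (residue_le_zeta _ _ _) (ltW _).
have [|||||e [e1 e2 e3]] := @near_product R ((z n).1 i 0)%:~R ((z n.+1).1 i 0)%:~R
  (residue Theta (z n) j) (residue Theta (z n.+1) j).
- by rewrite -normr_eq0 -Xi gt_eqF.
- by rewrite -normr_eq0 -Zj gt_eqF.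
- by rewrite -Xi.
- by rewrite -Zj.
- by rewrite -Xi -Zj; exact: small.
rewrite -Xi in e2; rewrite -Zj in e3.
have ne : `|e%:~R| = 1 :> R by case: e1 => ->; rewrite ?mulrN1z ?normrN normr1.
suff w0 : z n.+1 - e *: z n = 0.
  have : zeta Theta (z n.+1) < Z by exact: zS.
  rewrite /Z (_ : z n.+1 = e *: z n); last by apply/eqP; rewrite -subr_eq0 w0.
  by rewrite /zeta !residueZ !normrM ne !mul1r ltxx.
apply: (minimal_points_eq0 (n := n) mz).
  have [k ->] := height_attained (z n.+1 - e *: z n).1.
  rewrite -(ltr_int R) intr_norm -/X !mxE intrB intrM.
  rewrite -(ltr_pM2r Z_gt0); apply: (@le_lt_trans _ _ (X * Z / 4 + X * Z / 4)); last first.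
    have : 0 < X * Z by exact: mulr_gt0.
    by lra.
  rewrite [in leLHS]Zj -normrM.
  set u : R := ((z n).1 k 0)%:~R; set u' : R := ((z n.+1).1 k 0)%:~R.
  (* Multiplying the coordinate by a residue of size [Z] brings in a minor; both terms are at most
     [X * Z / 4]. The residues are treated dually below. *)
  rewrite (_ : (u' - e%:~R * u) * residue Theta (z n) j =
    - cross Theta (z n) (z n.+1) k j +
    u * (residue Theta (z n.+1) j - e%:~R * residue Theta (z n) j)); last first.
    by rewrite /cross -/u -/u'; ring.
  apply: le_trans (ler_normD _ _) _; rewrite normrN normrM; apply: lerD; first exact: ltW.
  by rewrite -mulrA; apply: ler_pM => //; exact: xX.
have [k ->] := zeta_attained Theta (z n.+1 - e *: z n).
rewrite residueB residueZ -/Z -(ltr_pM2l X_gt0).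
apply: (@le_lt_trans _ _ (X * Z / 4 + X * Z / 4)); last first.
  have : 0 < X * Z by exact: mulr_gt0.
  by lra.
rewrite [in leLHS]Xi -normrM.
set x : R := ((z n).1 i 0)%:~R in e2 *; set x' : R := ((z n.+1).1 i 0)%:~R in e2 *.
have ee : e%:~R * e%:~R = 1 :> R by case: e1 => ->; rewrite ?mulrN1z ?mulrNN mulr1.
rewrite (_ : x' * (residue Theta (z n.+1) k - e%:~R * residue Theta (z n) k) =
    e%:~R * cross Theta (z n) (z n.+1) i k +
    (x' - e%:~R * x) * residue Theta (z n.+1) k); last first.
  by rewrite /cross -/x -/x'; ring.
apply: le_trans (ler_normD _ _) _; rewrite !normrM ne mul1r; apply: lerD; first exact: ltW.
by rewrite mulrAC; apply: ler_pM.
Qed.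

Lemma cross_neq0 (R : realType) (Theta : 'M[R]_2) z n : minimal_points Theta z ->
  exists i j, cross Theta (z n) (z n.+1) i j != 0.
Proof.
move=> mz; have [h0 _ _ _ _] := mz; have [i [j h]] := zeta_height_le_cross n mz.
exists i, j; rewrite -normr_gt0 -(pmulr_rgt0 _ (_ : 0 < 4 :> R)) //.
by apply: lt_le_trans h; rewrite mulr_gt0 ?ltr0z // minimal_points_zeta_gt0.
Qed.

(** * The lattice of the plane of two consecutive minimal points *)

Definition in_span (R : realType) (w z z' : zpoint) := exists a b : R,
  (forall i, (w.1 i 0)%:~R = a * (z.1 i 0)%:~R + b * (z'.1 i 0)%:~R) /\
  (forall j, (w.2 j 0)%:~R = a * (z.2 j 0)%:~R + b * (z'.2 j 0)%:~R).

Lemma residue_comb (R : realType) (Theta : 'M[R]_2) (w z z' : zpoint) (a b : R) :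
  (forall i, (w.1 i 0)%:~R = a * (z.1 i 0)%:~R + b * (z'.1 i 0)%:~R) ->
  (forall j, (w.2 j 0)%:~R = a * (z.2 j 0)%:~R + b * (z'.2 j 0)%:~R) ->
  forall j, residue Theta w j = a * residue Theta z j + b * residue Theta z' j.
Proof.
move=> h1 h2 j; rewrite /residue /linform !big_ord_recl !big_ord0 h2 !h1; ring.
Qed.

Lemma round_half (R : realType) (a : R) : exists p : int, `|a - p%:~R| <= 1 / 2.
Proof.
exists (Num.floor (a + 1 / 2)).
have := floor_le_tmp (a + 1 / 2); have := floorD1_gt (a + 1 / 2).
rewrite intrD1 ler_norml => *; lra.
Qed.

(* Rounding the coefficients leaves a lattice point of height and residue too
   small to be nonzero. *)
Lemma in_span_int (R : realType) (Theta : 'M[R]_2) z n w : minimal_points Theta z ->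
  in_span R w (z n) (z n.+1) -> exists p q : int, w = p *: z n + q *: z n.+1.
Proof.
move=> mz [a [b [hx hy]]]; have [h0 hS zS _ _] := mz.
have [p hp] := round_half a; have [q hq] := round_half b; exists p, q.
apply/eqP; rewrite -subr_eq0; apply/eqP; apply: (minimal_points_eq0 (n := n) mz).
  have [i ->] := height_attained (w - (p *: z n + q *: z n.+1)).1.
  rewrite -(ltr_int R) intr_norm !mxE !intrB !intrD !intrM hx.
  set u : R := ((z n).1 i 0)%:~R; set u' : R := ((z n.+1).1 i 0)%:~R.
  rewrite (_ : a * u + b * u' - (p%:~R * u + q%:~R * u') =
    (a - p%:~R) * u + (b - q%:~R) * u'); last by ring.
  apply: le_lt_trans (ler_normD _ _) _; rewrite !normrM.
  apply: (@le_lt_trans _ _ (1 / 2 * (height (z n).1)%:~R + 1 / 2 * (height (z n.+1).1)%:~R)).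
    by apply: lerD; apply: ler_pM => //; exact: coord_le_heightr.
  by have := hS n; rewrite -(ltr_int R); lra.
have [k ->] := zeta_attained Theta (w - (p *: z n + q *: z n.+1)).
rewrite residueB residueD !residueZ (residue_comb Theta hx hy).
set u := residue Theta (z n) k; set u' := residue Theta (z n.+1) k.
rewrite (_ : a * u + b * u' - (p%:~R * u + q%:~R * u') =
  (a - p%:~R) * u + (b - q%:~R) * u'); last by ring.
apply: le_lt_trans (ler_normD _ _) _; rewrite !normrM.
apply: (@le_lt_trans _ _ (1 / 2 * zeta Theta (z n) + 1 / 2 * zeta Theta (z n.+1))).
  by apply: lerD; apply: ler_pM => //; exact: residue_le_zeta.
by have := zS n; lra.
Qed.

(** [cross] is bilinear and alternating, so a change of vectors multiplies it by the determinant. *)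
Lemma cross_comb (R : realType) (Theta : 'M[R]_2) (w w' z z' : zpoint) (p q p' q' : int) i j :
  w = p *: z + q *: z' -> w' = p' *: z + q' *: z' ->
  cross Theta w w' i j = (p * q' - q * p')%:~R * cross Theta z z' i j.
Proof.
move=> -> ->; rewrite /cross !residueD !residueZ !mxE !intrB !intrD !intrM; ring.
Qed.

(** Both pairs are bases of the lattice of their common plane, so the change of basis has
    determinant 1 or -1. *)
Lemma cross_same_span (R : realType) (Theta : 'M[R]_2) z m n i j : minimal_points Theta z ->
  in_span R (z m) (z n) (z n.+1) -> in_span R (z m.+1) (z n) (z n.+1) ->
  `|cross Theta (z m) (z m.+1) i j| = `|cross Theta (z n) (z n.+1) i j|.
Proof.
move=> mz /(in_span_int mz)[p [q zm]] /(in_span_int mz)[p' [q' zm']].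
have cr k l := cross_comb Theta k l zm zm'; set d : int := p * q' - q * p' in cr.
have [k [l c0]] := cross_neq0 m mz.
have d0 : d%:~R != 0 :> R.
  by apply: contra_neq c0 => d0; rewrite cr d0 mul0r.
have dE : d%:~R = p%:~R * q'%:~R - q%:~R * p'%:~R :> R by rewrite /d intrB !intrM.
(* Cramer's rule gives real coefficients, and [in_span_int] replaces them by integers. *)
have [s [t zn]] : exists s t : int, z n = s *: z m + t *: z m.+1.
  apply: (in_span_int mz); exists (q'%:~R / d%:~R), (- q%:~R / d%:~R).
  rewrite zm zm'; split=> k'; rewrite !mxE !intrD !intrM; move: d0; rewrite dE => d0;
    by field.
have [s' [t' zn']] : exists s t : int, z n.+1 = s *: z m + t *: z m.+1.
  apply: (in_span_int mz); exists (- p'%:~R / d%:~R), (p%:~R / d%:~R).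
  rewrite zm zm'; split=> k'; rewrite !mxE !intrD !intrM; move: d0; rewrite dE => d0;
    by field.
have cr' := cross_comb Theta k l zn zn'.
(* Composing the two changes of basis fixes a nonzero minor, so the integer [d] is a unit. *)
have : (d * (s * t' - t * s'))%:~R = 1 :> R.
  by apply: (mulIf c0); rewrite intrM -mulrA -cr' -cr mul1r.
rewrite -[1]/(1%:~R) => /intr_inj /(congr1 absz).
rewrite abszM => /eqP; rewrite muln_eq1 => /andP[/eqP d1 _].
have nd : `|d%:~R| = 1 :> R.
  by rewrite -intr_norm (_ : `|d| = 1) //; lia.
by rewrite cr normrM nd mul1r.
Qed.

(** * Four independent minimal points *)

Definition zrow (z : zpoint) : 'rV[int]_(2 + 2) := row_mx z.1^T z.2^T.

Definition residue_mx (R : realType) (Theta : 'M[R]_2) (z : zpoint) : 'rV[R]_(2 + 2) :=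
  row_mx (map_mx intr z.1^T) (\row_j residue Theta z j).

(** The right factor is block triangular of determinant 1, so replacing the coordinates [y] by
    residues preserves determinants. *)
Lemma residue_mxE (R : realType) (Theta : 'M[R]_2) (z : zpoint) :
  residue_mx Theta z = map_mx intr (zrow z) *m block_mx 1%:M Theta^T 0 (-1)%:M.
Proof.
rewrite /zrow map_row_mx mul_row_block mulmx1 mulmx0 addr0; congr row_mx.
apply/rowP => j; rewrite mul_mx_scalar !mxE /residue /linform mulN1r.
by congr (_ - _); apply: eq_bigr => i _; rewrite !mxE mulrC.
Qed.

(** [b] marks the factors taken from [X]. As [X] increases and [Z] decreases, each of the six
    choices is dominated by the two largest values of each. *)
Lemma prod_four_le (R : realType) (b : nat -> bool) (X Z : nat -> R) :
  (b 0 + b 1 + b 2 + b 3 = 2)%N ->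
  0 <= Z 3 -> Z 3 <= Z 2 -> Z 2 <= Z 1 -> Z 1 <= Z 0 ->
  0 <= X 0 -> X 0 <= X 1 -> X 1 <= X 2 -> X 2 <= X 3 ->
  \prod_(i < 4) (if b i then X i else Z i) <= Z 0 * Z 1 * (X 2 * X 3).
Proof.
move=> hb Z3 Z2 Z1 Z0 X0 X1 X2 X3; rewrite !big_ord_recl big_ord0 /= mulr1.
have [z2 z1 z0] : [/\ 0 <= Z 2, 0 <= Z 1 & 0 <= Z 0] by split; lra.
have [x1 x2 x3] : [/\ 0 <= X 1, 0 <= X 2 & 0 <= X 3] by split; lra.
have le4 (p q r s p' q' r' s' : R) : 0 <= p -> 0 <= q -> 0 <= r -> 0 <= s ->
    p <= p' -> q <= q' -> r <= r' -> s <= s' -> p * q * (r * s) <= p' * q' * (r' * s').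
  by move=> *; apply: ler_pM; rewrite ?mulr_ge0 //; apply: ler_pM.
rewrite /bump /= !add1n.
move: hb; case: (b 0); case: (b 1); case: (b 2); case: (b 3) => //= _.
- rewrite [leLHS](_ : _ = Z 2 * Z 3 * (X 0 * X 1)); last by ring.
  by apply: le4 => //; lra.
- rewrite [leLHS](_ : _ = Z 1 * Z 3 * (X 0 * X 2)); last by ring.
  by apply: le4 => //; lra.
- rewrite [leLHS](_ : _ = Z 1 * Z 2 * (X 0 * X 3)); last by ring.
  by apply: le4 => //; lra.
- rewrite [leLHS](_ : _ = Z 0 * Z 3 * (X 1 * X 2)); last by ring.
  by apply: le4 => //; lra.
- rewrite [leLHS](_ : _ = Z 0 * Z 2 * (X 1 * X 3)); last by ring.
  by apply: le4 => //; lra.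
- by rewrite [leLHS](_ : _ = Z 0 * Z 1 * (X 2 * X 3)) //; ring.
Qed.

(** A nonzero integer determinant is at least 1 in absolute value, and its Leibniz expansion in
    residues has [4! = 24] terms, each with two coordinates and two residues. *)
Lemma det_points_ge1 (R : realType) (Theta : 'M[R]_2) (w : nat -> zpoint) (X Z : nat -> R) :
  \det (\matrix_(i < 2 + 2) zrow (w i)) != 0 ->
  (forall i, (height (w i).1)%:~R <= X i) -> (forall i, zeta Theta (w i) <= Z i) ->
  0 <= Z 3 -> Z 3 <= Z 2 -> Z 2 <= Z 1 -> Z 1 <= Z 0 ->
  0 <= X 0 -> X 0 <= X 1 -> X 1 <= X 2 -> X 2 <= X 3 ->
  1 <= 24 * (Z 0 * Z 1 * (X 2 * X 3)).
Proof.
move=> dz hX hZ Z3 Z2 Z1 Z0 X0 X1 X2 X3.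
pose F : 'M[R]_(2 + 2) := \matrix_(i < 2 + 2) residue_mx Theta (w i).
have detF : \det F = (\det (\matrix_(i < 2 + 2) zrow (w i)))%:~R.
  have -> : F = map_mx intr (\matrix_(i < 2 + 2) zrow (w i)) *m
      block_mx 1%:M Theta^T 0 (-1)%:M.
    apply/row_matrixP => i; rewrite row_mul -map_row !rowK; exact: residue_mxE.
  rewrite det_mulmx det_ublock det1 mul1r det_scalar -det_map_mx.
  by rewrite sqrrN expr1n mulr1.
have F1 : 1 <= `|\det F|.
  by rewrite detF -intr_norm -[leLHS]/(1%:~R) ler_int; lia.
apply: le_trans F1 _; apply: le_trans (ler_norm_sum _ _ _) _.
have -> : 24 = #|'S_(2 + 2)|%:R :> R by rewrite card_Sn.
rewrite mulr_natl -sumr_const; apply: ler_sum => s _.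
rewrite normrM normr_sign mul1r normr_prod.
pose b (i : nat) := (s (inord i) < 2)%N.
apply: le_trans (prod_four_le (b := b) _ Z3 Z2 Z1 Z0 X0 X1 X2 X3).
  apply: ler_prod => i _; rewrite normr_ge0 /= mxE /b inord_val.
  case: ltnP => hs.
    have -> : s i = lshift 2 (Ordinal hs) by apply: val_inj.
    rewrite row_mxEl !mxE; apply: le_trans (hX i); exact: coord_le_heightr.
  have hs' : (s i - 2 < 2)%N by have := ltn_ord (s i); lia.
  have -> : s i = rshift 2 (Ordinal hs') by apply: val_inj => /=; lia.
  rewrite row_mxEr !mxE; apply: le_trans (hZ i); exact: residue_le_zeta.
have cnt : (\sum_(i < 2 + 2) (s i < 2) = 2)%N.
  transitivity (\sum_(i < 2 + 2) (i < 2))%N; last by rewrite !big_ord_recl big_ord0.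
  by rewrite [RHS](reindex_inj (@perm_inj _ s)).
rewrite -[RHS]cnt !big_ord_recl big_ord0 /b addn0 !addnA.
by do ?[congr (_ + _)%N]; congr (nat_of_bool (nat_of_ord (s _) < 2)%N);
  apply: val_inj; rewrite /= inordK.
Qed.

(* Linear independence of the four numbers and 1 keeps the minimal points out of
   every rational hyperplane, provided [zeta_n X_(n+1)] tends to 0: inside such a
   hyperplane consecutive [x_n] become parallel, which makes [cross] an integer. *)
Lemma minimal_points_hyperplane (R : realType) (Theta : 'M[R]_2) z N (a b : 'I_2 -> int) :
  entries_and_one_independent Theta -> minimal_points Theta z ->
  (forall e : R, 0 < e -> exists M, forall n, (M <= n)%N ->
     zeta Theta (z n) * (height (z n.+1).1)%:~R < e) ->
  (forall n, (N <= n)%N ->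
     \sum_i a i * (z n).1 i 0 + \sum_j b j * (z n).2 j 0 = 0) ->
  forall i, a i = 0 /\ b i = 0.
Proof.
move=> indep mz small hyp.
(* [c i] is the coefficient of [x_i] once each [y_j] is replaced by [L_j] minus its residue in the
   relation. *)
pose c i : R := (a i)%:~R + \sum_j (b j)%:~R * Theta j i.
have c0P i : c i = 0 -> a i = 0 /\ forall j, b j = 0.
  move=> ci; have [|-> /matrixP e] := indep (a i) (\matrix_(j, k) if k == i then b j else 0).
    rewrite -[RHS]ci; congr (_ + _); apply: eq_bigr => j _.
    rewrite (bigD1 i) //= big1 ?addr0 ?mxE ?eqxx // => k ki.
    by rewrite mxE (negbTE ki) mul0r.
  by split=> // j; have := e j i; rewrite !mxE eqxx.
suff call i : c i = 0 by move=> i; have [-> h] := c0P i (call i).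
apply: contrapT => ci.
pose B : R := \sum_j `|(b j)%:~R|.
have B0 : 0 <= B by rewrite sumr_ge0.
have ci0 : 0 < `|c i| by rewrite normr_gt0; apply/eqP.
(* The first bound will force the integer [D] to vanish, the second the integer [m]. *)
have [|M hM] := small (Num.min (`|c i| / (2 * B + 1)) (1 / 2)).
  by rewrite lt_min !divr_gt0 //; lra.
pose n := maxn M N.
have /hM : (M <= n)%N by exact: leq_maxl.
set S := _ * _; rewrite lt_min => /andP[S1 S2].
have [h0 hS zS _ _] := mz.
have lin m : (N <= m)%N -> c 0 * ((z m).1 0 0)%:~R + c 1 * ((z m).1 1 0)%:~R =
    \sum_j (b j)%:~R * residue Theta (z m) j.
  move=> /hyp /(congr1 (fun k : int => k%:~R : R)).
  rewrite /c /residue /linform !big_ord_recl !big_ord0 !intrD !intrM.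
  rewrite (_ : lift ord0 ord0 = 1) => [h|]; last exact: val_inj.
  apply/eqP; rewrite -subr_eq0; apply/eqP; rewrite -[RHS]h; ring.
have resB m : (n <= m)%N -> `|c 0 * ((z m).1 0 0)%:~R + c 1 * ((z m).1 1 0)%:~R| <=
    B * zeta Theta (z n).
  move=> nm; rewrite lin; last exact: leq_trans (leq_maxr _ _) nm.
  rewrite /B mulr_suml; apply: le_trans (ler_norm_sum _ _ _) _.
  apply: ler_sum => j _; rewrite normrM ler_wpM2l //.
  apply: le_trans (residue_le_zeta _ _ _) _.
  elim: m nm => [|m IH]; first by rewrite leqn0 => /eqP ->.
  rewrite leq_eqVlt => /orP[/eqP -> //|/IH]; apply: le_trans; exact: ltW.
pose D : int := (z n).1 0 0 * (z n.+1).1 1 0 - (z n).1 1 0 * (z n.+1).1 0 0.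
have xX m k : (m <= n.+1)%N -> (n <= m)%N ->
    `|((z m).1 k 0)%:~R| <= (height (z n.+1).1)%:~R :> R.
  move=> m1 m2; apply: le_trans (coord_le_heightr _ _ _) _; rewrite ler_int.
  by move: m1; rewrite leq_eqVlt ltnS => /orP[/eqP -> //|m3];
    rewrite (_ : m = n) ?ltW //; apply/eqP; rewrite eqn_leq m3.
have cD : `|c i * D%:~R| <= 2 * B * S.
  have twice (u v s t : R) : `|u| <= B * zeta Theta (z n) -> `|v| <= B * zeta Theta (z n) ->
      `|s| <= (height (z n.+1).1)%:~R -> `|t| <= (height (z n.+1).1)%:~R ->
      `|u * s - v * t| <= 2 * B * S.
    move=> hu hv hs ht; apply: le_trans (ler_normB _ _) _; rewrite !normrM.
    rewrite (_ : 2 * B * S = B * zeta Theta (z n) * (height (z n.+1).1)%:~R +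
      B * zeta Theta (z n) * (height (z n.+1).1)%:~R); last by rewrite /S; ring.
    by apply: lerD; apply: ler_pM.
  have r0 := resB n (leqnn _); have r1 := resB n.+1 (leqnSn _).
  elim/ord2P: i {hM ci ci0 S1} => /=.
    rewrite (_ : c 0 * _ = (c 0 * ((z n).1 0 0)%:~R + c 1 * ((z n).1 1 0)%:~R) *
       ((z n.+1).1 1 0)%:~R - (c 0 * ((z n.+1).1 0 0)%:~R + c 1 * ((z n.+1).1 1 0)%:~R) *
       ((z n).1 1 0)%:~R); last by rewrite /D intrB !intrM; ring.
    by apply: twice => //; apply: xX => //; exact: leqW.
  rewrite (_ : c 1 * _ = (c 0 * ((z n.+1).1 0 0)%:~R + c 1 * ((z n.+1).1 1 0)%:~R) *
     ((z n).1 0 0)%:~R - (c 0 * ((z n).1 0 0)%:~R + c 1 * ((z n).1 1 0)%:~R) *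
     ((z n.+1).1 0 0)%:~R); last by rewrite /D intrB !intrM; ring.
  by apply: twice => //; apply: xX => //; exact: leqW.
have S_gt0 : 0 < S by rewrite mulr_gt0 ?ltr0z // minimal_points_zeta_gt0.
have int0 (k : int) : `|k%:~R| < 1 :> R -> k = 0.
  by rewrite -intr_norm ltrz1 => ?; lia.
have D0 : D = 0.
  apply: int0; rewrite -(ltr_pM2l ci0) -normrM mulr1; apply: le_lt_trans cD _.
  move: S1; rewrite ltr_pdivlMr; last lra.
  by nra.
have [k [l]] := zeta_height_le_cross n mz; rewrite -/S.
(* When [D] is 0 the entries of [Theta] cancel from the minor, which leaves an integer. *)
pose m : int := - ((z n).1 k 0 * (z n.+1).2 l 0 - (z n.+1).1 k 0 * (z n).2 l 0).
have crE : cross Theta (z n) (z n.+1) k l = m%:~R.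
  have {}D0 : ((z n).1 0 0)%:~R * ((z n.+1).1 1 0)%:~R =
      ((z n).1 1 0)%:~R * ((z n.+1).1 0 0)%:~R :> R.
    by rewrite -!intrM; congr (_%:~R); apply/eqP; rewrite -subr_eq0; apply/eqP.
  rewrite /cross /m /residue /linform !big_ord_recl !big_ord0 intrN intrB !intrM.
  rewrite (_ : lift ord0 ord0 = 1); last exact: val_inj.
  apply/eqP; rewrite -subr_eq0; apply/eqP.
  elim/ord2P: k {m} => /=.
    transitivity (Theta l 1 * (((z n).1 0 0)%:~R * ((z n.+1).1 1 0)%:~R -
      ((z n).1 1 0)%:~R * ((z n.+1).1 0 0)%:~R)); first by ring.
    by rewrite D0 subrr mulr0.
  transitivity (- Theta l 0 * (((z n).1 0 0)%:~R * ((z n.+1).1 1 0)%:~R -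
    ((z n).1 1 0)%:~R * ((z n.+1).1 0 0)%:~R)); first by ring.
  by rewrite D0 subrr mulr0.
have m0 : m = 0.
  by apply: int0; rewrite -crE; apply: le_lt_trans (cross_le n k l mz) _; rewrite -/S; lra.
by rewrite crE m0 normr0; lra.
Qed.

(** * Rank of the minimal points over the rationals *)

Definition qrow (z : zpoint) : 'rV[rat]_(2 + 2) := map_mx intr (zrow z).

Lemma qrow_x (z : zpoint) i : qrow z 0 (lshift 2 i) = (z.1 i 0)%:~R.
Proof. by rewrite mxE row_mxEl mxE. Qed.

Lemma qrow_y (z : zpoint) j : qrow z 0 (rshift 2 j) = (z.2 j 0)%:~R.
Proof. by rewrite mxE row_mxEr mxE. Qed.

(** A common denominator, found by reading the vector as the coefficients of a polynomial. *)
Lemma rat_vector_scale n (w : 'cV[rat]_n) :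
  exists (d : int) (u : 'I_n -> int), d != 0 /\ forall i, d%:~R * w i 0 = (u i)%:~R.
Proof.
have [q [d d0 qE]] := rat_poly_scale (rVpoly w^T).
exists d, (fun i => q`_i); split=> // i.
have := congr1 (fun p : {poly rat} => p`_i) qE.
rewrite coef_rVpoly_ord mxE coefZ coef_map => -> /=.
by rewrite mulVKf // intr_eq0.
Qed.

(** Among the spans of finitely many points from [N] on, one of maximal rank contains all points
    from [N] on. If it were proper, a nonzero column of its cokernel, cleared of denominators, would
    give a hyperplane excluded by [minimal_points_hyperplane]. *)
Lemma minimal_points_full_rank (R : realType) (Theta : 'M[R]_2) z N :
  entries_and_one_independent Theta -> minimal_points Theta z ->
  (forall e : R, 0 < e -> exists M, forall n, (M <= n)%N ->
     zeta Theta (z n) * (height (z n.+1).1)%:~R < e) ->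
  exists m, \rank (\sum_(i < m) <<qrow (z (N + i)%N)>>)%MS = 4.
Proof.
move=> indep mz small; pose V m := (\sum_(i < m) <<qrow (z (N + i)%N)>>)%MS.
suff [m mV] : exists m, \rank (V m) = 4 by exists m.
pose P r := `[< exists m, \rank (V m) = r >].
have exP : exists r, P r by exists (\rank (V 0)); apply/asboolP; exists 0.
have ubP r : P r -> (r <= 4)%N by move=> /asboolP[m <-]; exact: (rank_leq_col (V m)).
case: (ex_maxnP exP ubP) => r /asboolP[m mr] rmax.
exists m; apply/eqP; rewrite eqn_leq (rank_leq_col (V m)) leqNgt; apply/negP => r4.
have inV i : (qrow (z (N + i)%N) <= V m)%MS.
  have VS p q : (p <= q)%N -> (V p <= V q)%MS.
    move=> pq; apply/sumsmx_subP => k _; apply: (sumsmx_sup (widen_ord pq k)) => //.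
  have sub : (V m <= V (maxn m i.+1))%MS by apply: VS; exact: leq_maxl.
  have [_ eq] := mxrank_leqif_sup sub.
  apply: (@submx_trans _ _ _ _ _ _ (V (maxn m i.+1))).
    have hi : (i < maxn m i.+1)%N by exact: leq_maxr.
    by apply: (sumsmx_sup (Ordinal hi)) => //; rewrite genmxE.
  rewrite -eq eqn_leq (mxrankS sub) /= mr; apply: rmax; apply/asboolP.
  by exists (maxn m i.+1).
have cok : cokermx (V m) != 0.
  by rewrite -mxrank_eq0 mxrank_coker subn_eq0 -ltnNge.
have [k wk] : exists k, col k (cokermx (V m)) != 0.
  apply: contrapT => H; move/eqP: cok; apply; apply/matrixP => i k.
  have : col k (cokermx (V m)) = 0 by apply: contrapT => /eqP h; apply: H; exists k.
  by move=> /colP/(_ i); rewrite !mxE.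
set w := col k _ in wk; have w0 i : qrow (z (N + i)%N) *m w = 0.
  have /submxP[u ->] := inV i.
  by rewrite /w colE mulmxA -(mulmxA u) mulmx_coker mulmx0 mul0mx.
have [d [u [d0 du]]] := rat_vector_scale w.
have u0 := minimal_points_hyperplane (N := N) (a := fun i => u (lshift 2 i))
  (b := fun j => u (rshift 2 j)) indep mz small.
case/eqP: wk; apply/colP => i; rewrite [RHS]mxE.
suff ui : u i = 0.
  by have /eqP := du i; rewrite ui mulf_eq0 intr_eq0 (negbTE d0) => /eqP.
suff uu : forall i, u (lshift 2 i) = 0 /\ u (rshift 2 i) = 0.
  by case: (split_ordP i) => j ->; have [] := uu j.
apply: u0 => n Nn.
have /rowP/(_ 0) := w0 (n - N)%N; rewrite subnKC // [RHS]mxE mxE big_split_ord /=.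
move=> /(congr1 (fun r => d%:~R * r)); rewrite mulr0 mulrDr !mulr_sumr => h.
apply: (@intr_inj rat); rewrite -[RHS]h intrD !rmorph_sum.
by congr (_ + _); apply: eq_bigr => l _; rewrite /= ?qrow_x ?qrow_y mulrCA du intrM mulrC.
Qed.

Lemma qrow_in_span (R : realType) (w z z' : zpoint) :
  (qrow w <= qrow z + qrow z')%MS -> in_span R w z z'.
Proof.
move=> /sub_addsmxP[u e]; exists (ratr (u.1 0 0)), (ratr (u.2 0 0)).
have ek k : qrow w 0 k = u.1 0 0 * qrow z 0 k + u.2 0 0 * qrow z' 0 k.
  by rewrite e [LHS]mxE [X in X + _ = _]mxE [X in _ + X = _]mxE !big_ord1.
by split=> i; [have := ek (lshift 2 i)|have := ek (rshift 2 i)];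
  rewrite ?qrow_x ?qrow_y => /(congr1 (@ratr R)); rewrite rmorphD !rmorphM /= !ratr_int.
Qed.

(** A linear relation passes to the residues, and eliminating one coefficient leaves the other times
    a nonzero minor. *)
Lemma qrow_consecutive_free (R : realType) (Theta : 'M[R]_2) z n (a b : rat) :
  minimal_points Theta z -> a *: qrow (z n) + b *: qrow (z n.+1) = 0 -> a = 0 /\ b = 0.
Proof.
move=> mz e; have [i [j c0]] := cross_neq0 n mz.
have ek k : a * qrow (z n) 0 k + b * qrow (z n.+1) 0 k = 0.
  have /rowP/(_ k) := e; rewrite [RHS]mxE => h; rewrite -[RHS]h.
  by rewrite [RHS]mxE [X in _ = X + _]mxE [X in _ = _ + X]mxE.
have ex k : ratr a * ((z n).1 k 0)%:~R + ratr b * ((z n.+1).1 k 0)%:~R = 0 :> R.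
  have := ek (lshift 2 k); rewrite !qrow_x => /(congr1 (@ratr R)).
  by rewrite rmorphD !rmorphM /= !ratr_int rmorph0.
have ey k : ratr a * ((z n).2 k 0)%:~R + ratr b * ((z n.+1).2 k 0)%:~R = 0 :> R.
  have := ek (rshift 2 k); rewrite !qrow_y => /(congr1 (@ratr R)).
  by rewrite rmorphD !rmorphM /= !ratr_int rmorph0.
have er : ratr a * residue Theta (z n) j + ratr b * residue Theta (z n.+1) j = 0.
  rewrite -[LHS](@residue_comb R Theta 0 (z n) (z n.+1)).
  - by rewrite /residue linform0 mxE subrr.
  - by move=> k; rewrite mxE ex.
  - by move=> k; rewrite mxE ey.
have ex' := ex i; split; apply/eqP; rewrite -(fmorph_eq0 (@ratr R)); apply/eqP.
  apply: (mulIf c0); rewrite mul0r /cross.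
  transitivity ((ratr a * ((z n).1 i 0)%:~R + ratr b * ((z n.+1).1 i 0)%:~R) *
    residue Theta (z n.+1) j - ((z n.+1).1 i 0)%:~R *
    (ratr a * residue Theta (z n) j + ratr b * residue Theta (z n.+1) j)); first by ring.
  by rewrite ex' er; ring.
apply: (mulIf c0); rewrite mul0r /cross.
transitivity (((z n).1 i 0)%:~R *
  (ratr a * residue Theta (z n) j + ratr b * residue Theta (z n.+1) j) -
  (ratr a * ((z n).1 i 0)%:~R + ratr b * ((z n.+1).1 i 0)%:~R) *
  residue Theta (z n) j); first by ring.
by rewrite ex' er; ring.
Qed.

(** Defined on all of [nat], as [det_points_ge1] expects; index 3 falls under the default case. *)
Definition pick4 (T : Type) (a b c d : T) (i : nat) : T :=
  match i with 0%N => a | 1%N => b | 2%N => c | _ => d end.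

(* With [n + 2] the first index at which the points from [N] on span the whole
   space, [j <= n + 1] is the last index outside the plane of [z_n, z_(n+1)]. *)
Lemma independent_quadruple (R : realType) (Theta : 'M[R]_2) z N :
  entries_and_one_independent Theta -> minimal_points Theta z ->
  (forall e : R, 0 < e -> exists M, forall n, (M <= n)%N ->
     zeta Theta (z n) * (height (z n.+1).1)%:~R < e) ->
  exists j n, [/\ (N <= j < n)%N, in_span R (z j.+1) (z n) (z n.+1),
    in_span R (z j.+2) (z n) (z n.+1) &
    \det (\matrix_(i < 2 + 2) zrow (pick4 (z j) (z n) (z n.+1) (z n.+2) i)) != 0].
Proof.
move=> indep mz small.
pose V m := (\sum_(i < m) <<qrow (z (N + i)%N)>>)%MS.
have VS m : (V m.+1 :=: V m + qrow (z (N + m)%N))%MS.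
  by rewrite /V big_ord_recr /=; apply: adds_eqmx => //; exact: genmxE.
have rS m : (\rank (V m.+1) <= (\rank (V m)).+1)%N.
  rewrite VS; apply: leq_trans (mxrank_adds_leqif _ _) _.
  by rewrite -[X in (_ <= X)%N]addn1 leq_add2l rank_rV leq_b1.
have rm m : (\rank (V m) <= m)%N.
  elim: m => [|m IH]; first by rewrite /V big_ord0 mxrank0.
  by apply: leq_trans (rS m) _.
have exm : exists m, \rank (V m) == 4%N.
  by have [m h] := minimal_points_full_rank N indep mz small; exists m; apply/eqP.
case: (ex_minnP exm) => m /eqP m4 mmin.
have m_ge4 : (4 <= m)%N by rewrite -m4.
case: m m4 m_ge4 mmin => // m m4 m_ge3 mmin.
(* The rank grows by at most one per point, so it is 3 just before it first reaches 4. *)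
have r3 : (\rank (V m) == 3)%N.
  rewrite eqn_leq; apply/andP; split; last by have := rS m; rewrite m4.
  rewrite -ltnS ltn_neqAle (rank_leq_col (V m)) andbT.
  by apply/negP => /mmin; rewrite ltnn.
have out : ~~ (qrow (z (N + m)%N) <= V m)%MS.
  apply/negP => h; have : (V m.+1 <= V m)%MS by rewrite VS addsmx_sub submx_refl.
  by move=> /mxrankS; rewrite m4 (eqP r3).
(* Here [m] is at least 3, so the subtraction is not truncated. *)
pose n := (N + m - 2)%N.
have nE : (N + m = n.+2)%N by rewrite /n; lia.
pose plane := (qrow (z n) + qrow (z n.+1))%MS.
have inV i : (N <= i < n.+2)%N -> (qrow (z i) <= V m)%MS.
  move=> hi; have lt : (i - N < m)%N by lia.
  apply: (sumsmx_sup (Ordinal lt)) => //=; rewrite genmxE subnKC //; lia.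
have plane2 : (\rank plane <= 2)%N.
  apply: leq_trans (mxrank_adds_leqif _ _) _.
  by rewrite (leq_add (n1 := 1) (n2 := 1)) // rank_rV leq_b1.
pose P i := ((N <= i < n.+2)%N && ~~ (qrow (z i) <= plane)%MS).
(* The points from [N] to [n.+1] have rank 3, so they cannot all lie in the plane. *)
have exP : exists i, P i.
  apply: contrapT => H; have : (V m <= plane)%MS.
    apply/sumsmx_subP => i _; rewrite genmxE; apply: contrapT => /negP h; apply: H.
    by exists (N + i)%N; rewrite /P h andbT; have := ltn_ord i; lia.
  by move=> /mxrankS; rewrite (eqP r3) => /leq_trans /(_ plane2).
have ubP i : P i -> (i <= n.+2)%N by move=> /andP[/andP[_ /ltnW]].
case: (ex_maxnP exP ubP) => j /andP[/andP[Nj jn] jplane] jmax.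
have inplane i : (j < i < n.+2)%N -> (qrow (z i) <= plane)%MS.
  move=> /andP[ji hi]; apply: contrapT => /negP h.
  have /jmax : P i by rewrite /P h hi (leq_trans Nj (ltnW ji)).
  by rewrite leqNgt ji.
have jltn : (j < n)%N.
  rewrite ltnNge leq_eqVlt; apply/negP => /orP[/eqP e|].
    by move: jplane; rewrite -e addsmxSl.
  move=> nj; have e : j = n.+1 by lia.
  by move: jplane; rewrite e addsmxSr.
exists j, n; split.
- by rewrite Nj.
- by apply: qrow_in_span; apply: inplane; lia.
- by apply: qrow_in_span; apply: inplane; lia.
pose A := \matrix_(i < 2 + 2) qrow (pick4 (z j) (z n) (z n.+1) (z n.+2) i).
suff : \det A != 0.
  have -> : A = map_mx intr (\matrix_(i < 2 + 2) zrow (pick4 (z j) (z n) (z n.+1) (z n.+2) i)).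
    by apply/row_matrixP => i; rewrite -map_row !rowK.
  by rewrite det_map_mx intr_eq0.
(* In a vanishing combination the coefficient of [z n.+2] is 0 as this point raises the rank, then
   that of [z j] as it is outside the plane, then the other two as consecutive points are
   independent. *)
rewrite -unitfE -unitmxE -row_free_unit; apply: inj_row_free => v.
rewrite mulmx_sum_row !big_ord_recl big_ord0 !rowK /= addr0.
set v0 := v 0 _; set v1 := v 0 _; set v2 := v 0 _; set v3 := v 0 _ => e.
have sub_of (U : 'M[rat]_(2 + 2)) (u : 'rV[rat]_(2 + 2)) (c : rat) :
    (c *: u <= U)%MS -> ~~ (u <= U)%MS -> c = 0.
  by move=> cu; apply: contraNeq => c0; rewrite -(eqmx_scale u c0).
have v3_0 : v3 = 0.
  apply: (sub_of (V m) (qrow (z n.+2))); last by rewrite -nE.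
  have -> : v3 *: qrow (z n.+2) =
      - (v0 *: qrow (z j) + (v1 *: qrow (z n) + v2 *: qrow (z n.+1))).
    by apply/eqP; rewrite -addr_eq0 addrC -!addrA e.
  by rewrite eqmx_opp !addmx_sub // scalemx_sub // inV //; lia.
rewrite v3_0 scale0r addr0 in e.
have v0_0 : v0 = 0.
  apply: (sub_of plane (qrow (z j))) => //.
  have -> : v0 *: qrow (z j) = - (v1 *: qrow (z n) + v2 *: qrow (z n.+1)).
    by apply/eqP; rewrite -addr_eq0 e.
  by rewrite eqmx_opp !addmx_sub // scalemx_sub // ?addsmxSl ?addsmxSr.
rewrite v0_0 scale0r add0r in e; have [v1_0 v2_0] := qrow_consecutive_free mz e.
apply/rowP => i; rewrite [RHS]mxE.
case: i => [[|[|[|[|//]]]] hi].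
- by rewrite -v0_0; congr (v 0 _); apply: val_inj.
- by rewrite -v1_0; congr (v 0 _); apply: val_inj.
- by rewrite -v2_0; congr (v 0 _); apply: val_inj.
- by rewrite -v3_0; congr (v 0 _); apply: val_inj.
Qed.

(** * Exponents *)

(** Eliminating [v] bounds [d * u] by a constant, [d] being the supposed defect in the conclusion,
    while [u] is unbounded. The elimination multiplies by [b + g - g ^+ 2]; if that is not positive,
    the first inequality alone bounds [u]. *)
Lemma exponent_ineq_of_log (R : realType) (g b C1 C2 : R) : 1 < g ->
  (forall H : R, exists u v, [/\ H <= u, 0 <= v,
     g ^+ 2 * u <= (b + g - g ^+ 2) * v + C1 & (g - 1) * v <= (b - 1) * u + C2]) ->
  g ^+ 2 * (g - 1) <= (b + g - g ^+ 2) * (b - 1).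
Proof.
move=> g1 hyp; set B := b + g - g ^+ 2 in hyp *.
have [B0|B0] := leP B 0.
  have [u [v [hu v0 h1 h2]]] := hyp (`|C1| + 1).
  have C1n := ler_norm C1; have Bv : B * v <= 0 by rewrite mulr_le0_ge0.
  have : u <= g ^+ 2 * u.
    by rewrite ler_peMl ?exprn_ege1 //; [have := normr_ge0 C1; lra|lra].
  lra.
rewrite leNgt; apply/negP; rewrite -subr_gt0 => d0.
set d := _ - _ in d0; set C3 := B * C2 + (g - 1) * C1.
have [u [v [hu v0 h1 h2]]] := hyp ((C3 + 1) / d).
have h3 : d * u <= C3.
  have k1 : (g - 1) * (g ^+ 2 * u) <= (g - 1) * (B * v + C1) by rewrite ler_wpM2l //; lra.
  have k2 : B * ((g - 1) * v) <= B * ((b - 1) * u + C2) by rewrite ler_pM2l.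
  rewrite (_ : d * u = (g - 1) * (g ^+ 2 * u) - B * ((b - 1) * u)); last by rewrite /d; ring.
  by rewrite /C3; lra.
by move: hu; rewrite ler_pdivrMr // mulrC => hu; lra.
Qed.

Lemma log_height_unbounded (R : realType) (Theta : 'M[R]_2) z (H : R) :
  minimal_points Theta z ->
  exists M, forall n, (M <= n)%N -> H <= ln (height (z n).1)%:~R.
Proof.
move=> [h0 hS _ _ _].
have hn n : n%:Z < height (z n).1.
  by elim: n => [|n IH]; [exact: h0|have := hS n; lia].
exists (Num.truncn (expR H)).+1 => n Mn.
rewrite -[H]expRK ler_ln ?posrE ?expR_gt0 ?ltr0z //.
apply: ltW; apply: lt_le_trans (truncnS_gt _) _.
by rewrite pmulrn ler_int; apply: le_trans (ltW (hn n)); exact: Mn.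
Qed.

Lemma exponent_ineq (R : realType) (Theta : 'M[R]_2) z (g b k : R) N :
  entries_and_one_independent Theta -> minimal_points Theta z -> 1 < g ->
  (forall n, (N <= n)%N ->
     ln (zeta Theta (z n)) + g * ln (height (z n.+1).1)%:~R <= k) ->
  (forall n, (N <= n)%N -> 0 <= ln (zeta Theta (z n)) + b * ln (height (z n).1)%:~R) ->
  g ^+ 2 * (g - 1) <= (b + g - g ^+ 2) * (b - 1).
Proof.
move=> indep mz g1 hU hO; have [h0 hS zS _ _] := mz.
pose X n : R := (height (z n).1)%:~R; pose Z n := zeta Theta (z n).
have X0 n : 0 < X n by rewrite ltr0z.
have Z0 n : 0 < Z n by exact: minimal_points_zeta_gt0.
have XS m n : (m <= n)%N -> X m <= X n.
  apply: (homo_leq (r := fun x y => x <= y)) => // [? ? ?|i]; first exact: le_trans.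
  by rewrite ler_int ltW.
have ZS m n : (m <= n)%N -> Z n <= Z m.
  apply: (homo_leq (r := fun x y => y <= x)) => // [? ? ? h1 h2|i].
    exact: le_trans h2 h1.
  exact: ltW (zS i).
have X1 n : 1 <= X n by rewrite -[1]/(1%:~R) ler_int; have := h0 n; lia.
have lnX n : 0 <= ln (X n) by rewrite ln_ge0.
(* The logarithm of [Z n * X n.+1] is at most [k - (g - 1) * ln (X n.+1)], which tends to minus
   infinity as [g > 1]. *)
have small (e : R) : 0 < e -> exists M, forall n, (M <= n)%N -> Z n * X n.+1 < e.
  move=> e0.
  have [M hM] := log_height_unbounded ((k - ln e + 1) / (g - 1)) mz.
  exists (maxn M N) => n; rewrite geq_max => /andP[Mn Nn].
  rewrite -ltr_ln ?posrE ?mulr_gt0 // lnM ?posrE //.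
  have := hU n Nn; have := hM n.+1 (leqW Mn); rewrite -/(X n.+1) -/(Z n).
  rewrite ler_pdivrMr ?subr_gt0 // => ? ?; nra.
apply: (@exponent_ineq_of_log R g b (g * (ln 24 + 2 * k) + k) (ln 8 + k)) => // H.
have [M hM] := log_height_unbounded H mz.
have [j [n [/andP[Nj jn] s1 s2 dt]]] := independent_quadruple (maxn M N) indep mz small.
have [Mj N'j] : (M <= j)%N /\ (N <= j)%N by move: Nj; rewrite geq_max => /andP.
have Nn : (N <= n)%N by exact: leq_trans N'j (ltnW jn).
(* The indices [v < k] of the introduction are [j.+1 < n.+1]. *)
exists (ln (X j.+1)), (ln (X n.+1)); split=> //; first exact: hM (leqW Mj).
  have Q1 : 0 <= ln 24 + ln (Z j) + ln (Z n) + ln (X n.+1) + ln (X n.+2).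
    have := @det_points_ge1 R Theta _ (fun i => X (pick4 j n n.+1 n.+2 i))
      (fun i => Z (pick4 j n n.+1 n.+2 i)) dt.
    move=> h; have {}h : 1 <= 24 * (Z j * Z n * (X n.+1 * X n.+2)).
      apply: h => /=; try (by apply: XS; lia); try (by apply: ZS; lia); try exact: ltW.
        by case=> [|[|[|i]]]; apply: lexx.
      by case=> [|[|[|i]]]; apply: lexx.
    move: h; rewrite -ler_ln ?posrE ?mulr_gt0 // ln1 !lnM ?posrE ?mulr_gt0 //.
    by rewrite !addrA.
  have := hU j N'j; have := hU n Nn; have := hU n.+1 (leqW Nn); have := hO n.+1 (leqW Nn).
  rewrite -/(Z j) -/(Z n) -/(Z n.+1) -/(X j.+1) -/(X n.+1) -/(X n.+2) => a1 a2 a3 a4.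
  (* The determinant bound is multiplied by [g] because [a1] and [a2] control [g * ln (X n.+2)]. *)
  have a5 : g * (0 - (ln 24 + ln (Z j) + ln (Z n) + ln (X n.+1) + ln (X n.+2))) <= 0.
    by rewrite mulr_ge0_le0 //; lra.
  have a6 : g * (ln (Z j) + g * ln (X j.+1) + (ln (Z n) + g * ln (X n.+1)) - 2 * k) <= 0.
    by rewrite mulr_ge0_le0 //; lra.
  by rewrite expr2; lra.
(* The 8 is [4 * 2], from [zeta_height_le_cross] at [j.+1] and [cross_le] at [n]. *)
have Q2 : ln (Z j.+1) + ln (X j.+2) <= ln 8 + ln (Z n) + ln (X n.+1).
  have [i [l hc]] := zeta_height_le_cross j.+1 mz.
  rewrite (cross_same_span _ _ mz s1 s2) in hc.
  have := cross_le n i l mz; rewrite -/(Z n) -/(X n.+1) => hc'.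
  rewrite -!lnM ?posrE ?mulr_gt0 // ler_ln ?posrE ?mulr_gt0 //.
  by move: hc; rewrite -/(Z j.+1) -/(X j.+2); lra.
have := hU n Nn; have := hO j.+1 (leqW N'j).
have : ln (X j.+1) <= ln (X j.+2) by rewrite ler_ln ?posrE // XS.
rewrite -/(Z j.+1) -/(Z n) -/(X j.+1) -/(X n.+1) => a1 a2 a3.
by lra.
Qed.

(** * From Jarnik's function to minimal points *)

Lemma limf_esup_lty (R : realType) (f : R -> R) :
  (limf_esup (fun t => (f t)%:E) (pinfty_nbhs R) < +oo)%E <->
  exists K T, forall t, T < t -> f t <= K.
Proof.
rewrite limf_esupE; split.
  move=> /ereal_inf_lt [_ [V [T [_ TV]] <-]] supV.
  have ub t : T < t -> ((f t)%:E <= ereal_sup ((fun t => (f t)%:E) @` V))%E.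
    by move=> Tt; apply: ereal_sup_ubound; exists t => //; exact: TV.
  move: supV ub; case: (ereal_sup _) => [r _ ub|//|_ ub].
    by exists r, T => t /ub; rewrite lee_fin.
  by have := ub (T + 1); rewrite ltrDl ltr01 => /(_ isT).
move=> [K [T H]]; apply: le_lt_trans (ltry K); apply: ge_ereal_inf.
exists (ereal_sup ((fun t => (f t)%:E) @` [set t | T < t])).
  by exists [set t | T < t] => //; exists T; split=> //; exact: num_real.
by apply: ge_ereal_sup => _ [t Tt <-]; rewrite lee_fin; exact: H.
Qed.

Lemma limf_einf_eqy (R : realType) (f : R -> R) (K : R) :
  ~ (limf_einf (fun t => (f t)%:E) (pinfty_nbhs R) < +oo)%E ->
  exists T, forall t, T < t -> K <= f t.
Proof.
move=> /negP; rewrite -leNgt leye_eq limf_einfE => /eqP h.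
have : (K%:E < ereal_sup [set ereal_inf ((fun t => (f t)%:E) @` V) | V in pinfty_nbhs R])%E.
  by rewrite h ltry.
move=> /ereal_sup_gt [_ [V [T [_ TV]] <-]] infV; exists T => t Tt.
rewrite -lee_fin; apply: le_trans (ltW infV) _; apply: ereal_inf_lbound.
by exists t => //; exact: TV.
Qed.

(** Dirichlet's theorem at the integer part [T] of [t] bounds [t * jarnik_psi Theta t] by
    [(T + 1) / T <= 2]. *)
Lemma uniform_exponent_ge1 (R : realType) (Theta : 'M[R]_2) :
  (1 <= uniform_exponent Theta)%E.
Proof.
apply: ereal_sup_ubound; exists 1 => //=.
apply/limf_esup_lty; exists 2, 1 => t t1; have t0 : 0 < t by lra.
rewrite powRr1; last exact: ltW.
have T0 : (0 < Num.truncn t)%N by rewrite truncn_gt0 ltW.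
have [x [x0 xT xr]] := dirichlet Theta T0.
have /truncn_itv/andP[t2 t3] : 0 <= t by exact: ltW.
have ht : (height x)%:~R <= t.
  by apply: le_trans t2; rewrite pmulrn ler_int.
have := jarnik_psi_le Theta x0 ht => /le_trans/(_ xr) hpsi.
have : t * jarnik_psi Theta t <= t * (Num.truncn t)%:R^-1 by rewrite ler_pM2l.
move=> /le_trans; apply.
have T1 : 1 <= (Num.truncn t)%:R :> R by rewrite ler1n.
rewrite ler_pdivrMr; last lra.
by move: t3; rewrite -addn1 natrD; lra.
Qed.

Lemma uniform_le_ordinary (R : realType) (Theta : 'M[R]_2) :
  (uniform_exponent Theta <= ordinary_exponent Theta)%E.
Proof.
apply: le_ereal_sup => _ [g hg <-]; exists g => //=.
move/limf_esup_lty: hg => [K [T H]]; apply: contrapT => /(limf_einf_eqy (K + 1)) [T' H'].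
have [h1 h2] : T < Num.max T T' + 1 /\ T' < Num.max T T' + 1.
  by rewrite -!ltrBlDr !lt_max; split; apply/orP; [left|right]; lra.
by have := H _ h1; have := H' _ h2; lra.
Qed.

(** At half the height of [z n.+1] Jarnik's function is at least [zeta Theta (z n)], as every vector
    allowed there is lower than [z n.+1]; at the height of [z n] it is at most this. Logarithms give
    the hypotheses of [exponent_ineq], where [g * ln 2] is the cost of halving. *)
Lemma exponent_ineq_psi (R : realType) (Theta : 'M[R]_2) (g b : R) :
  entries_and_one_independent Theta -> 1 < g ->
  (limf_esup (fun t : R => (t `^ g * jarnik_psi Theta t)%:E) (pinfty_nbhs R) < +oo)%E ->
  ~ (limf_einf (fun t : R => (t `^ b * jarnik_psi Theta t)%:E) (pinfty_nbhs R) < +oo)%E ->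
  g ^+ 2 * (g - 1) <= (b + g - g ^+ 2) * (b - 1).
Proof.
move=> indep g1 /limf_esup_lty [K [T hU]] /(limf_einf_eqy 1) [T' hO].
have [z mz] := exists_minimal_points indep; have [h0 hS zS zr rmin] := mz.
(* A height [X] of at least [H] makes [X / 2] at least 1 and above [T], and [X] above [T']. *)
pose H := Num.max (2 * `|T| + 2) (`|T'| + 2).
have H0 : 2 <= H by rewrite /H le_max; have := normr_ge0 T; lra.
have HT : 2 * T < H by rewrite /H lt_max; have := ler_norm T; have := normr_ge0 T; lra.
have HT' : T' < H by rewrite /H lt_max; have := ler_norm T'; have := normr_ge0 T'; lra.
have [M hM] := log_height_unbounded (ln H) mz.
have hX n : (M <= n)%N -> H <= (height (z n).1)%:~R.
  by move=> /hM; rewrite ler_ln ?posrE ?ltr0z //; lra.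
apply: (@exponent_ineq R Theta z g b (ln K + g * ln 2) M indep mz g1) => n Mn.
  have hn := hX n.+1 (leqW Mn); set X : R := (height (z n.+1).1)%:~R in hn *.
  have X0 : 0 < X by lra.
  have psi : zeta Theta (z n) <= jarnik_psi Theta (X / 2).
    apply: le_jarnik_psi; first by rewrite ler_pdivlMr //; lra.
    move=> x x0 hx; apply: rmin => //; rewrite -(ltr_int R) -/X; lra.
  have z0 : 0 < zeta Theta (z n) by exact: minimal_points_zeta_gt0.
  have p0 : 0 < (X / 2) `^ g by apply: powR_gt0; lra.
  have le : (X / 2) `^ g * zeta Theta (z n) <= K.
    by apply: le_trans (hU (X / 2) _); [rewrite ler_pM2l|rewrite ltr_pdivlMr //; lra].
  have K0 : 0 < K by apply: lt_le_trans le; exact: mulr_gt0.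
  move: le; rewrite -ler_ln ?posrE ?mulr_gt0 // lnM ?posrE // ln_powR ln_div ?posrE //.
  lra.
have hn := hX n Mn; set X : R := (height (z n).1)%:~R in hn *.
have X0 : 0 < X by lra.
have z0 : 0 < zeta Theta (z n) by exact: minimal_points_zeta_gt0.
have psi : jarnik_psi Theta X <= zeta Theta (z n).
  by rewrite zr; apply: jarnik_psi_le.
have p0 : 0 < X `^ b by exact: powR_gt0.
have : 1 <= X `^ b * zeta Theta (z n).
  by apply: le_trans (hO X _) _; [lra|rewrite ler_pM2l].
rewrite -ler_ln ?posrE ?mulr_gt0 // ln1 lnM ?posrE // ln_powR; lra.
Qed.

Lemma exponent_quadratic (R : realType) (g b : R) : 1 < g -> g <= b ->
  g ^+ 2 * (g - 1) <= (b + g - g ^+ 2) * (b - 1) ->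
  2 * g ^+ 3 - 2 * g ^+ 2 + g <= b ^+ 2 + b * (g - 1).
Proof.
move=> g1 gb h.
have : 0 <= g ^+ 2 * (b - g) by rewrite mulr_ge0 ?sqr_ge0 ?subr_ge0.
by move: h; rewrite !exprS expr0 !mulr1; lra.
Qed.

(** [a * g3 a] is the larger root of the quadratic in [b] given by equality in the hypothesis.
    Completing the square bounds its discriminant by [(2 * b + a - 1) ^+ 2]. *)
Lemma mul_g3_le (R : realType) (a b : R) : 1 <= a -> 0 <= b ->
  2 * a ^+ 3 - 2 * a ^+ 2 + a <= b ^+ 2 + b * (a - 1) -> a * g3 a <= b.
Proof.
move=> a1 b0 h; rewrite /g3; set D := (X in Num.sqrt X).
rewrite (_ : a * _ = (1 - a + Num.sqrt D) / 2); last by field; lra.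
have : Num.sqrt D <= 2 * b + a - 1.
  have c0 : 0 <= 2 * b + a - 1 by lra.
  rewrite -[leRHS]ger0_norm // -sqrtr_sqr ler_wsqrtr // /D.
  by move: h; rewrite !exprS expr0 !mulr1; lra.
lra.
Qed.

Theorem theorem22 (R : realType) (Theta : 'M[R]_2)
    (indep : entries_and_one_independent Theta) :
  (uniform_exponent Theta * g3e (uniform_exponent Theta)
     <= ordinary_exponent Theta)%E.
Proof.
have := uniform_le_ordinary Theta; have := uniform_exponent_ge1 Theta.
(* An infinite ordinary exponent makes the bound trivial; otherwise both exponents are real, the
   uniform one lying between 1 and the ordinary one. *)
case aE : (uniform_exponent Theta) => [a||]; case bE : (ordinary_exponent Theta) => [b||] //;
  rewrite ?leey // !lee_fin => a1 ab.
apply: mul_g3_le => //; first by lra.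
rewrite leNgt; apply/negP; rewrite -subr_gt0; set d := _ - _ => d0.
(* For [a = 1] no admissible [g > 1] is available, but the bound reads [1 <= b ^+ 2]. *)
have [a_le1|a_gt1] := leP a 1.
  have {}aE : a = 1 by lra.
  by move: d0; rewrite /d aE !expr1n; nra.
(* The suprema need not be attained, so [a] and [b] are replaced by some [g] in []a - r, a]] and by
   [b + s]. The factors [6 * a ^+ 2 + 1] and [2 * b + 1 + a] bound the rates of change, so each
   replacement costs at most [d / 4]; [r <= a - 1] keeps [g > 1]. *)
pose r := Num.min (a - 1) (d / (4 * (6 * a ^+ 2 + 1))).
pose s := Num.min 1 (d / (4 * (2 * b + 1 + a))).
have A0 : 0 < 6 * a ^+ 2 + 1 by rewrite ltr_wpDl // mulr_ge0 ?sqr_ge0.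
have [r0 r1 r2] : [/\ 0 < r, r <= a - 1 & (6 * a ^+ 2 + 1) * r <= d / 4].
  rewrite lt_min ge_min lexx subr_gt0 a_gt1 divr_gt0 ?mulr_gt0 //; split=> //.
  rewrite mulrC -ler_pdivlMr // /r ge_min; apply/orP; right.
  by rewrite le_eqVlt; apply/orP; left; apply/eqP; field; rewrite gt_eqF.
have B0 : 0 < 2 * b + 1 + a by lra.
have [s0 s1 s2] : [/\ 0 < s, s <= 1 & (2 * b + 1 + a) * s <= d / 4].
  rewrite lt_min ge_min lexx ltr01 divr_gt0 ?mulr_gt0 //; split=> //.
  rewrite mulrC -ler_pdivlMr // /s ge_min; apply/orP; right.
  by rewrite le_eqVlt; apply/orP; left; apply/eqP; field; rewrite gt_eqF.
have : ((a - r)%:E < uniform_exponent Theta)%E by rewrite aE lte_fin; lra.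
move=> /ereal_sup_gt [_ [g gU <-]]; rewrite lte_fin => ga.
have g_lea : g <= a.
  by rewrite -lee_fin -aE; apply: ereal_sup_ubound; exists g.
have nO : ~ (limf_einf (fun t : R => (t `^ (b + s) * jarnik_psi Theta t)%:E)
    (pinfty_nbhs R) < +oo)%E.
  move=> sO; have : ((b + s)%:E <= ordinary_exponent Theta)%E.
    by apply: ereal_sup_ubound; exists (b + s).
  by rewrite bE lee_fin; lra.
have g1 : 1 < g by lra.
have := exponent_ineq_psi indep g1 gU nO; move=> /(exponent_quadratic g1) q.
have {}q : 2 * g ^+ 3 - 2 * g ^+ 2 + g <= (b + s) ^+ 2 + (b + s) * (g - 1) by apply: q; lra.
have e1 : (b + s) ^+ 2 + (b + s) * (g - 1) <= b ^+ 2 + b * (a - 1) + (2 * b + 1 + a) * s.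
  have : 0 <= s * (1 - s) by rewrite mulr_ge0 //; lra.
  have : 0 <= (b + s) * (a - g) by rewrite mulr_ge0 //; lra.
  by rewrite !expr2; nra.
have e2 : 2 * a ^+ 3 - 2 * a ^+ 2 + a <=
    2 * g ^+ 3 - 2 * g ^+ 2 + g + (6 * a ^+ 2 + 1) * r.
  have k1 : (6 * a ^+ 2 + 1) * (a - g) <= (6 * a ^+ 2 + 1) * r by rewrite ler_pM2l //; lra.
  have k2 : 0 <= (a - g) * (6 * a ^+ 2 + 1 - (2 * (a ^+ 2 + a * g + g ^+ 2) - 2 * (a + g) + 1)).
    rewrite mulr_ge0 ?subr_ge0 // !expr2; nra.
  by move: k1 k2; rewrite !exprS !expr0 !mulr1; lra.
by move: d0; rewrite /d => d0; move: r2 s2; rewrite /d; lra.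
Qed.
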